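(* Let $\boldsymbol{a}=(a_1,a_2,\dots)$ be a sequence of integers with $a_j>1$ for all $j\ge 1$, and let $$X=H_{\boldsymbol{a}}=\left\{\frac{m}{a_1a_2\cdots a_n}: n=1,2,\dots;\ m\in\mathbb{Z}\right\}\subset\mathbb{Q},$$ regarded as a discrete additive group. Put $e_{\pm 0}=\pm 1$ and $e_{\pm n}=\pm\frac{1}{a_1\cdots a_n}$ for $n\ge 1$. Let $\mu$ be a probability distribution on $X$ of the form $$\mu\{e_{\pm j}\}=\frac{q_j}{2},\qquad \sum_{j=0}^{\infty}q_j=1,\qquad q_j\ge 0 \quad (j=0,1,2,\dots).$$ Consider on $X$ the random walk defined by $\mu$. The condition $$\sum_{n=1}^{\infty}\frac{1}{a_1\cdots a_n\sqrt{q_n+q_{n+1}+\cdots}}=\infty$$ is sufficient for recurrence of the random walk defined by $\mu$ on $X$.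
   Context: Given a probability distribution $\mu$ on a countable discrete Abelian group $X$, the random walk on $X$ defined by $\mu$ is the sequence $S_n=\xi_1+\dots+\xi_n$, $n=1,2,\dots$, where $\xi_1,\xi_2,\dots$ are independent identically distributed random variables with values in $X$ and distribution $\mu$, defined on a probability space $(\Omega,\mathfrak{A},P)$. The random walk is called recurrent if every element of $X$ is recurrent, i.e. for every $x\in X$, $$P\{\omega\in\Omega: S_n(\omega)=x \text{ for infinitely many indices } n\in\mathbb{N}\}=1.$$ *)

(* Defs.v *)
From HB Require Import structures.
From mathcomp Require Import all_boot all_order all_algebra.
From mathcomp Require Import finmap.
From mathcomp Require Import all_classical all_reals all_analysis.

Set Implicit Arguments.
Unset Strict Implicit.
Unset Printing Implicit Defensive.

Import Order.TTheory GRing.Theory Num.Theory.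
Import numFieldNormedType.Exports.

Local Open Scope classical_set_scope.
Local Open Scope ring_scope.

(* Only a_1, a_2, ... are used; a 0 is irrelevant. *)
Definition denom (a : nat -> int) (n : nat) : int := \prod_(1 <= i < n.+1) a i.

Definition H_pred (a : nat -> int) : {pred rat} :=
  [pred x : rat | `[< exists n : nat, (1 <= n)%N /\
                      exists m : int, x = m%:~R / (denom a n)%:~R >]].

Lemma denom_dvd a n l : (n <= l)%N -> exists c : int, denom a l = c * denom a n.
Proof.
move=> nl; exists (\prod_(n.+1 <= i < l.+1) a i).
by rewrite /denom mulrC (@big_cat_nat _ _ _ n.+1 1 l.+1).
Qed.

Lemma H_pred_zmod a : zmod_closed (H_pred a).
Proof.
split=> [|x y].
  by apply/asboolP; exists 1%N; split => //; exists 0; rewrite mul0r.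
move=> /asboolP[n [n1 [m ->]]] /asboolP[l [l1 [k ->]]].
apply/asboolP.
have [n0|n0] := eqVneq (denom a n) 0.
  by exists l; split => //; exists (- k); rewrite n0 invr0 mulr0 sub0r mulrNz mulNr.
have [l0|l0] := eqVneq (denom a l) 0.
  by exists n; split => //; exists m; rewrite l0 invr0 mulr0 subr0.
have [nl|/ltnW ln] := leqP n l.
- have [c cE] := denom_dvd a nl; exists l; split => //; exists (m * c - k).
  move: l0; rewrite cE mulf_eq0 negb_or => /andP[c0 _].
  rewrite intrD mulrNz mulrDl mulNr !intrM; congr (_ - _).
  by rewrite invfM mulrA mulfK// intr_eq0.
- have [c cE] := denom_dvd a ln; exists n; split => //; exists (m - k * c).
  move: n0; rewrite cE mulf_eq0 negb_or => /andP[c0 _].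
  rewrite intrD mulrNz mulrDl mulNr !intrM; congr (_ - _).
  by rewrite [in RHS]invfM mulrA mulfK// intr_eq0.
Qed.

HB.instance Definition _ (a : nat -> int) :=
  GRing.isZmodClosed.Build rat (H_pred a) (H_pred_zmod a).

Definition H (a : nat -> int) : Type := {x : rat | H_pred a x}.

HB.instance Definition _ (a : nat -> int) := SubType.on (H a).
HB.instance Definition _ (a : nat -> int) := [Countable of H a by <:].
HB.instance Definition _ (a : nat -> int) :=
  [SubChoice_isSubZmodule of H a by <:].
HB.instance Definition _ (a : nat -> int) := isPointed.Build (H a) 0.

(* H a is discrete: every subset is measurable. *)
HB.instance Definition _ (a : nat -> int) :=
  @isMeasurable.Build default_measure_display (H a)
    (@discrete_measurable (H a)) (@discrete_measurable0 (H a))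
    (@discrete_measurableC (H a)) (@discrete_measurableU (H a)).

Lemma e_subproof (a : nat -> int) (ha : forall j, (1 <= j)%N -> 1 < a j) n :
  H_pred a (denom a n)%:~R^-1.
Proof.
apply/asboolP; case: n => [|n]; last by exists n.+1; split => //; exists 1; rewrite mul1r.
exists 1%N; split => //; exists (a 1%N).
rewrite /denom big_nil big_nat1 divff ?invr1// intr_eq0.
by rewrite gt_eqF// (lt_trans ltr01)// ha.
Qed.

(* e ha n is e_{+n}, and e_{-n} is its opposite; e ha 0 = 1 since the product
   denom a 0 is empty. *)
Definition e (a : nat -> int) (ha : forall j, (1 <= j)%N -> 1 < a j) (n : nat) :
  H a := exist _ (denom a n)%:~R^-1 (e_subproof ha n).

Section random_walk.
Context d (T : measurableType d) (R : realType) (P : probability T R).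

Definition mutually_independent d' (X : measurableType d')
    (xi : nat -> {RV P >-> X}) : Prop :=
  forall (J : {fset nat}) (A : nat -> set X), (forall i, measurable (A i)) ->
    P (\bigcap_(i in [set` J]) (xi i @^-1` A i)) =
    (\prod_(i <- J) P (xi i @^-1` A i))%E.

Definition iid_with_distribution d' (X : measurableType d')
    (mu : probability X R) (xi : nat -> {RV P >-> X}) : Prop :=
  (forall i (A : set X), measurable A -> distribution P (xi i) A = mu A) /\
  mutually_independent xi.

(* The increments are numbered from 0, so walk xi n is a sum of n terms. *)
Definition walk (X : zmodType) (xi : nat -> T -> X) (n : nat) (w : T) : X :=
  \sum_(i < n) xi i w.

Definition recurrent (X : zmodType) (S : nat -> T -> X) : Prop :=
  forall x : X,
    P [set w | infinite_set [set n | (1 <= n)%N /\ S n w = x]] = 1%E.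

End random_walk.

Definition tail (R : realType) (q : nat -> R) (n : nat) : R :=
  fine (\sum_(n <= j <oo) (q j)%:E)%E.

(* The inverse is the total one of R: an index n with tail q n = 0, for which the
   term is not defined, contributes 0. If there is such an n, then tail q k = 0
   for all k >= n, the series is finite and the condition below fails. Reading
   1/0 as infinity would be wrong here: if q_j = 0 for all j >= n, the walk stays
   in the cyclic subgroup generated by 1 / denom a n.-1, a proper subgroup of
   H a, and the remaining elements are never visited. *)
Definition recurrence_condition (R : realType) (a : nat -> int) (q : nat -> R) :
    Prop :=
  (\sum_(1 <= n <oo) ((denom a n)%:~R * Num.sqrt (tail q n))^-1%:E)%E = +oo%E.

(* Main.v *)
Require Import Defs.
From HB Require Import structures.
From mathcomp Require Import finmap.
From mathcomp Require Import all_boot all_order all_algebra.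
From mathcomp Require Import ring lra.
From mathcomp Require Import all_classical all_reals all_analysis.

Set Implicit Arguments.
Unset Strict Implicit.
Unset Printing Implicit Defensive.

Import Order.TTheory GRing.Theory Num.Theory.
Import numFieldNormedType.Exports.

Local Open Scope classical_set_scope.
Local Open Scope ring_scope.

(** Write [D n] for the denominator [denom a n], [t n] for [tail q n] and [u k x]
for the probability that the walk is at [x] after [k] steps.

Local bound. Fix [n] and kill the walk at its first step of index at least [n].
The surviving walk lives on the lattice of multiples of [1 / D n]; after [k] steps
it has mass [(1 - t n) ^ k >= 1 - k t n], and second moment at most [k] because no
step is longer than 1. By Chebyshev, if [k t n <= 1/2], it carries a fixed mass on
about [sqrt k * D n] lattice points. The killed walk is symmetric, so
[u (2k) 0 >= sum_x u k x * u k (- x)] dominates the sum of its squared weights, and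
the Cauchy-Schwarz inequality gives [u (2k) 0 >= c / (D n * sqrt k)]
([return_prob_ge]).

Summation. Each [k] may use any [n] with [k t n <= 1/2]. As [D n] at least doubles
at each step, adding up the bounds over all these [n] costs only a factor 2
compared with the best of them. Exchanging the sums, [sum_k u (2k) 0] dominates a
multiple of [sum_n 1 / D n * sum_(k <= 1 / (2 t n)) 1 / sqrt k], which is at least
[sum_n 1 / (D n * sqrt (t n))] up to constants ([sum_unbounded_of_local_bound]).
So the Green function at 0 is infinite.

Recurrence. The events that the last visit to 0 takes place at time [n] are
disjoint, and each has probability [u n 0] times the probability of never
returning; divergence forces the latter to vanish ([never_return0]). Since
infinitely many [q j] are positive, every point can be reached with positive
probability, and then every point is visited infinitely often almost surely
([recurrent_criterion]). *)

(** * Random elements of countable types *)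

Section discrete_laws.
Context d (T : measurableType d) (R : realType) (U : countType).

Lemma measurable_preimage_countType (F : T -> U) (A : set U) :
  (forall u, measurable (F @^-1` [set u])) -> measurable (F @^-1` A).
Proof.
move=> mF; have -> : F @^-1` A = \bigcup_(u in A) F @^-1` [set u].
  by apply/seteqP; split=> [w Aw|w [u Au /= Fwu]]; [by exists (F w)|by rewrite /preimage/= Fwu].
rewrite bigcup_mkcond; apply: countable_bigcupT_measurable => [|u].
  exact: countableP.
by case: ifP.
Qed.

(** Both sides split over the atoms of [A] by countable additivity; numbering the
atoms by [pickle] makes the sum a series over [nat], some of whose slices are
empty. Two functions and two measures are allowed so that the lemma serves both
for stationarity and for independence. *)
Lemma eq_law_countType (F G : T -> U) (m1 m2 : {measure set T -> \bar R}) A :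
  (forall u, measurable (F @^-1` [set u])) ->
  (forall u, measurable (G @^-1` [set u])) ->
  (forall u, m1 (F @^-1` [set u]) = m2 (G @^-1` [set u])) ->
  m1 (F @^-1` A) = m2 (G @^-1` A).
Proof.
move=> mF mG eFG.
pose slice k := [set u : U | pickle u = k].
have split_law (K : T -> U) (m : {measure set T -> \bar R}) :
    (forall u, measurable (K @^-1` [set u])) ->
    m (K @^-1` A) = (\sum_(0 <= k <oo)
      m (K @^-1` (A `&` slice k)))%E.
  move=> mK; have -> : K @^-1` A =
      \bigcup_k K @^-1` (A `&` slice k).
    by apply/seteqP; split=> [w Aw|w [k _ []]//]; exists (pickle (K w)).
  rewrite measure_semi_bigcup//.
  - by move=> k; exact: measurable_preimage_countType.
  - apply/trivIsetP => i j _ _ /eqP ij; rewrite -subset0 => w [[_ /= wi] [_ /= wj]].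
    by apply: ij; rewrite -wi -wj.
  - by apply: bigcup_measurable => k _; exact: measurable_preimage_countType.
rewrite !split_law//; apply: eq_eseriesr => k _.
case: (pselect (exists2 u, A u & pickle u = k)) => [[u Au uk]|no].
  suff -> : A `&` slice k = [set u] by [].
  apply/seteqP; split=> [v [_ /= vk]|v ->//].
  by apply: (pcan_inj (@pickleK U)); rewrite vk uk.
suff -> : A `&` slice k = set0 by rewrite !preimage_set0 !measure0.
by rewrite -subset0 => v [Av vk]; apply: no; exists v.
Qed.
End discrete_laws.

(** The two factors are freed one at a time: with one event fixed, both sides are
measures in the other, namely a restriction of [P] and a multiple of [P]. *)
Lemma indep_countType d (T : measurableType d) (R : realType)
    (P : probability T R) (U V : countType) (F : T -> U) (G : T -> V)
    (A : set U) (B : set V) :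
  (forall u, measurable (F @^-1` [set u])) ->
  (forall v, measurable (G @^-1` [set v])) ->
  (forall u v, P (F @^-1` [set u] `&` G @^-1` [set v]) =
    P (F @^-1` [set u]) * P (G @^-1` [set v]))%E ->
  P (F @^-1` A `&` G @^-1` B) = (P (F @^-1` A) * P (G @^-1` B))%E.
Proof.
move=> mF mG FG.
have scaleP (D : set T) (mD : measurable D) : exists c : {nonneg R},
    P D = (c%:num)%:E.
  have PD : 0 <= fine (P D) by rewrite fine_ge0.
  by exists (NngNum PD); rewrite /= fineK// fin_num_measure.
have mGB : measurable (G @^-1` B) by exact: measurable_preimage_countType.
have FB u : P (F @^-1` [set u] `&` G @^-1` B) =
    (P (F @^-1` [set u]) * P (G @^-1` B))%E.
  have [c cE] := scaleP _ (mF u).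
  have law v : mrestr P (mF u) (G @^-1` [set v]) =
      mscale c P (G @^-1` [set v]).
    by rewrite /mrestr /mscale/= setIC FG cE.
  have := eq_law_countType B mG mG law.
  by rewrite /mrestr /mscale/= setIC cE.
have [c cE] := scaleP _ mGB.
have law u : mrestr P mGB (F @^-1` [set u]) = mscale c P (F @^-1` [set u]).
  by rewrite /mrestr /mscale/= FB cE muleC.
by have := eq_law_countType A mF mF law; rewrite /mrestr /mscale/= cE muleC.
Qed.

(** * The law of the walk and the Markov property *)

Definition block (T X : Type) (xi : nat -> T -> X) (n L : nat) (w : T) : seq X :=
  [seq xi i w | i <- iota n L].

(** The form in which independence is used: an initial or shifted block of steps
takes a given list of values with the product probability. *)
Definition iid_steps d (T : measurableType d) (R : realType)
    (P : probability T R) (X : eqType) (m : X -> R) (xi : nat -> T -> X) : Prop :=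
  (forall i x, measurable (xi i @^-1` [set x])) /\
  (forall n v, P (block xi n (size v) @^-1` [set v]) = (\prod_(x <- v) m x)%:E).

Definition walk_prob d (T : measurableType d) (R : realType)
    (P : probability T R) (X : zmodType) (xi : nat -> T -> X) (n : nat) (x : X) : R :=
  fine (P [set w | walk xi n w = x]).

Definition never d (T : measurableType d) (X : zmodType) (xi : nat -> T -> X) (y : X) : set T :=
  [set w | forall j, (1 <= j)%N -> walk xi j w <> y].

Section walk_law.
Context d (T : measurableType d) (R : realType) (P : probability T R).
Context (X : countZmodType) (m : X -> R) (xi : nat -> T -> X).
Context (iid : iid_steps P m xi).

Lemma block_cat n L M w : block xi n (L + M) w = block xi n L w ++ block xi (n + L) M w.
Proof. by rewrite /block iotaD map_cat. Qed.

Lemma size_block n L w : size (block xi n L w) = L.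
Proof. by rewrite size_map size_iota. Qed.

Lemma measurable_block n L v : measurable (block xi n L @^-1` [set v]).
Proof.
elim: L n v => [|L IH] n v.
  rewrite (_ : _ @^-1` _ = [set w | [::] = v])//.
  by have [<-|/eqP nv] := eqVneq [::] v;
    [rewrite (_ : [set w | _] = setT)// | rewrite (_ : [set w | _] = set0)//];
    apply/seteqP; split.
case: v => [|x v].
  by rewrite (_ : _ @^-1` _ = set0)//; apply/seteqP; split.
have -> : block xi n L.+1 @^-1` [set x :: v] =
    xi n @^-1` [set x] `&` block xi n.+1 L @^-1` [set v].
  by apply/seteqP; split=> w /=; rewrite {1}/block /=; [case=> <- <- | case=> <- <-].
by apply: measurableI => //; exact: iid.1.
Qed.

Lemma law_block n L (B : set (seq X)) :
  P (block xi n L @^-1` B) = P (block xi 0 L @^-1` B).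
Proof.
apply: eq_law_countType; try exact: measurable_block.
move=> v; have [<-|/eqP vL] := eqVneq (size v) L.
  exact: etrans (iid.2 _ _) (esym (iid.2 _ _)).
have no k : block xi k L @^-1` [set v] = set0.
  by rewrite -subset0 => w /= bv; apply: vL; rewrite -bv size_block.
by rewrite !no !measure0.
Qed.

(** It is enough to compare atoms, where two consecutive blocks taking the values
[u] and [v] are one block taking the value [u ++ v]. *)
Lemma block_indep n L (A B : set (seq X)) :
  P (block xi 0 n @^-1` A `&` block xi n L @^-1` B) =
  (P (block xi 0 n @^-1` A) * P (block xi 0 L @^-1` B))%E.
Proof.
rewrite -(law_block n L B); apply: indep_countType; try exact: measurable_block.
move=> u v.
have no k M y : size y <> M -> block xi k M @^-1` [set y] = set0.
  by move=> yM; rewrite -subset0 => w /= bv; apply: yM; rewrite -bv size_block.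
have [un|/eqP un] := eqVneq (size u) n; last by rewrite no// set0I measure0 mul0e.
have [vL|/eqP vL] := eqVneq (size v) L; last first.
  by rewrite [X in _ `&` X]no// [X in (_ * P X)%E]no// setI0 measure0 mule0.
rewrite -un -vL !iid.2 -EFinM -big_cat -(iid.2 0%N) size_cat.
congr (P _); apply/seteqP; split=> w /=; rewrite block_cat add0n.
  by move=> [-> ->].
move=> /eqP; rewrite eqseq_cat ?size_block// => /andP[/eqP -> /eqP ->].
by [].
Qed.

Lemma walk_block n w : walk xi n w = \sum_(x <- block xi 0 n w) x.
Proof. by rewrite big_map -[n in iota 0 n]subn0 big_mkord. Qed.

Lemma walkD n L j w : (j <= L)%N ->
  walk xi (n + j) w = walk xi n w + \sum_(x <- take j (block xi n L w)) x.
Proof.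
move=> jL; rewrite !walk_block block_cat big_cat/= add0n; congr (_ + _).
by rewrite -(subnKC jL) block_cat take_size_cat// size_block.
Qed.

Lemma measurable_walk n (A : set X) : measurable (walk xi n @^-1` A).
Proof.
rewrite (_ : _ @^-1` _ =
    block xi 0 n @^-1` [set v | A (\sum_(x <- v) x)]); last first.
  by apply/seteqP; split=> w /=; rewrite walk_block.
by apply: measurable_preimage_countType => v; exact: measurable_block.
Qed.

Lemma walk_indep n L x (B : set (seq X)) :
  P ([set w | walk xi n w = x] `&` block xi n L @^-1` B) =
  (P [set w | walk xi n w = x] * P (block xi 0 L @^-1` B))%E.
Proof.
have -> : [set w | walk xi n w = x] =
    block xi 0 n @^-1` [set v | \sum_(y <- v) y = x].
  by apply/seteqP; split=> w /=; rewrite walk_block.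
exact: block_indep.
Qed.

Lemma walk_restart n L x y :
  P ([set w | walk xi n w = x] `&` [set w | walk xi (n + L) w = x + y]) =
  (P [set w | walk xi n w = x] * P [set w | walk xi L w = y])%E.
Proof.
have -> : [set w | walk xi L w = y] =
    block xi 0 L @^-1` [set v | \sum_(z <- v) z = y].
  by apply/seteqP; split=> w /=; rewrite walk_block.
rewrite -walk_indep; congr (P _); apply/seteqP; split=> w /= [wx];
  rewrite (walkD _ _ (leqnn L)) take_oversize ?size_block// wx.
  by move=> /addrI.
by move=> ->.
Qed.

Lemma measurable_avoid_after n y :
  measurable [set w | forall j, (1 <= j)%N -> walk xi (n + j) w <> y].
Proof.
have -> : [set w | forall j, (1 <= j)%N -> walk xi (n + j) w <> y] =
    \bigcap_(j in [set j | (1 <= j)%N]) (walk xi (n + j) @^-1` (~` [set y])).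
  by apply/seteqP; split=> w h j /=; apply: h.
by apply: bigcap_measurableType => j _; exact: measurable_walk.
Qed.

Lemma measurable_never y : measurable (never xi y).
Proof. exact: (measurable_avoid_after 0 y). Qed.

(** The Markov property for an event on the infinite future: it is the decreasing
limit of events on the next [L] steps, which are events on a block. *)
Lemma never_after n x y :
  P ([set w | walk xi n w = x] `&`
     [set w | forall j, (1 <= j)%N -> walk xi (n + j) w <> x + y]) =
  (P [set w | walk xi n w = x] * P (never xi y))%E.
Proof.
pose avoid k z L : set T :=
  [set w | forall j, (1 <= j <= L)%N -> walk xi (k + j) w <> z].
have mavoid k z L : measurable (avoid k z L).
  rewrite (_ : avoid k z L = \bigcap_(j in [set j | (1 <= j <= L)%N])
      (walk xi (k + j) @^-1` (~` [set z]))).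
    by apply: bigcap_measurableType => j _; exact: measurable_walk.
  by apply/seteqP; split=> w h j /=; apply: h.
have avoid_ni k z : nonincreasing_seq (avoid k z).
  move=> L M LM; apply/subsetPset => w h j /andP[j1 jL].
  by apply: h; rewrite j1 (leq_trans jL).
have eqL L : P ([set w | walk xi n w = x] `&` avoid n (x + y) L) =
    (P [set w | walk xi n w = x] * P (avoid 0%N y L))%E.
  pose B : set (seq X) :=
    [set v | forall j, (1 <= j <= L)%N -> \sum_(z <- take j v) z <> y].
  have -> : avoid 0%N y L = block xi 0 L @^-1` B.
    apply/seteqP; split=> w h j /[dup] jL /h; rewrite add0n.
      by rewrite -[j in walk xi j]add0n (@walkD _ L) ?(andP jL).2// /walk big_ord0 add0r.
    by rewrite -[j in walk xi j]add0n (@walkD _ L) ?(andP jL).2// /walk big_ord0 add0r.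
  rewrite -walk_indep; congr (P _); apply/seteqP; split=> w /= [wx h];
    split=> // j /[dup] jL /h; rewrite (@walkD _ L) ?(andP jL).2// wx => ne.
    by move=> e; apply: ne; rewrite e.
  by move=> /addrI.
have mx : measurable [set w | walk xi n w = x] by exact: (measurable_walk n [set x]).
have capE k z : \bigcap_L avoid k z L =
    [set w | forall j, (1 <= j)%N -> walk xi (k + j) w <> z].
  apply/seteqP; split=> w h j; last by move=> _ i /andP[i1 _]; exact: h.
  by move=> j1; apply: (h j I); rewrite j1 leqnn.
have lim1 : P ([set w | walk xi n w = x] `&` avoid n (x + y) L) @[L --> \oo] -->
    P ([set w | walk xi n w = x] `&`
       [set w | forall j, (1 <= j)%N -> walk xi (n + j) w <> x + y]).
  rewrite -capE -bigcapIr; last by exists 0%N.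
  apply: (@nonincreasing_cvg_mu _ _ _ P
    (fun L => [set w | walk xi n w = x] `&` avoid n (x + y) L)).
  - by rewrite (le_lt_trans (probability_le1 _ _))// ?ltry//; exact: measurableI.
  - by move=> L; exact: measurableI.
  - by apply: bigcapT_measurable => L; exact: measurableI.
  - by move=> L M LM; apply/subsetPset; apply: setIS; apply/subsetPset/avoid_ni.
have lim2 : P (avoid 0%N y L) @[L --> \oo] --> P (never xi y).
  have -> : never xi y = \bigcap_L avoid 0%N y L by rewrite capE.
  apply: (@nonincreasing_cvg_mu _ _ _ P (avoid 0%N y)) => //.
  - by rewrite (le_lt_trans (probability_le1 _ _))// ltry.
  - exact: bigcapT_measurable.
have lim3 : (P [set w | walk xi n w = x] * P (avoid 0%N y L))%E @[L --> \oo] -->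
    (P [set w | walk xi n w = x] * P (never xi y))%E.
  by apply: cvgeZl => //; exact: fin_num_measure.
by rewrite -(funext eqL) in lim3; exact: cvg_unique lim1 lim3.
Qed.
End walk_law.

(** * Recurrence from an infinite Green function *)

Lemma last_visit (A : nat -> Prop) k N :
  A k -> (forall n, (N < n)%N -> ~ A n) ->
  exists l, A l /\ forall j, (1 <= j)%N -> ~ A (l + j)%N.
Proof.
move=> Ak bounded.
have ex : exists n, `[< A n >] by exists k; apply/asboolP.
have ub n : `[< A n >] -> (n <= N)%N.
  by move=> /asboolP An; rewrite leqNgt; apply/negP => /bounded.
case: (ex_maxnP ex ub) => l /asboolP Al lmax; exists l; split=> // j j1 Alj.
by have := lmax (l + j)%N (asboolT Alj); rewrite -[leqRHS]addn0 leq_add2l leqNgt j1.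
Qed.

Section recurrence.
Context d (T : measurableType d) (R : realType) (P : probability T R).
Context (X : countZmodType) (m : X -> R) (xi : nat -> T -> X).
Context (iid : iid_steps P m xi).

Lemma measurable_walk1 n x : measurable [set w | walk xi n w = x].
Proof. exact: (measurable_walk iid n [set x]). Qed.

Lemma walk_probE n x : P [set w | walk xi n w = x] = (walk_prob P xi n x)%:E.
Proof. by rewrite fineK// fin_num_measure//; exact: measurable_walk1. Qed.

Lemma walk_prob_ge0 n x : 0 <= walk_prob P xi n x.
Proof. by rewrite fine_ge0. Qed.

Lemma walk_prob00 : walk_prob P xi 0 0 = 1.
Proof.
rewrite /walk_prob (_ : [set w | _] = setT) ?probability_setT//.
by apply/seteqP; split=> w // _; rewrite /= /walk big_ord0.
Qed.

Lemma walk_prob1 x : walk_prob P xi 1 x = m x.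
Proof.
have -> : m x = \prod_(y <- [:: x]) m y by rewrite big_seq1.
rewrite /walk_prob -[RHS]/(fine (_%:E)) -(iid.2 0%N); congr (fine (P _)).
apply/seteqP; split=> w /=; rewrite /walk big_ord1 /block/=; first by move=> ->.
by case.
Qed.

(** One half of the Chapman-Kolmogorov equation, with finitely many intermediate
points: this suffices for lower bounds and avoids infinite sums. *)
Lemma walk_prob_split n L z (s : seq X) : uniq s ->
  \sum_(x <- s) walk_prob P xi n x * walk_prob P xi L (z - x) <=
  walk_prob P xi (n + L) z.
Proof.
move=> us; rewrite -lee_fin -walk_probE.
pose F x := [set w | walk xi n w = x] `&` [set w | walk xi (n + L) w = x + (z - x)].
have mF x : measurable (F x) by apply: measurableI; exact: measurable_walk1.
rewrite -sumEFin (eq_bigr (fun x => P (F x))); last first.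
  by move=> x _; rewrite /F (walk_restart iid) !walk_probE.
rewrite fsbig_seq// -measure_fin_bigcup//; last first.
  apply/trivIsetP => x y _ _ /eqP xy; rewrite -subset0 => w [[/= wx _] [/= wy _]].
  by apply: xy; rewrite -wx -wy.
apply: le_measure; rewrite ?inE.
- by apply: fin_bigcup_measurable.
- exact: measurable_walk1.
- by move=> w [x _ [_ /= ->]]; rewrite addrC subrK.
Qed.

(** There is at most one last visit to 0, so the probabilities that it takes place
at time [n], each the product of [walk_prob P xi n 0] and the probability of never
returning, have sum at most 1. *)
Lemma never_return0 :
  (forall M : R, exists K, M <= \sum_(n < K) walk_prob P xi n 0) ->
  P (never xi 0) = 0%E.
Proof.
move=> unbounded; set p := P (never xi 0).
have pfin : p = (fine p)%:E by rewrite fineK// fin_num_measure//; exact: measurable_never iid _.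
have p0 : 0 <= fine p by apply: fine_ge0; exact: measure_ge0.
have bound K : (\sum_(n < K) walk_prob P xi n 0) * fine p <= 1.
  pose F n := [set w | walk xi n w = 0] `&`
    [set w | forall j, (1 <= j)%N -> walk xi (n + j) w <> 0 + 0].
  have mF n : measurable (F n).
    apply: measurableI; first exact: measurable_walk1.
    exact: measurable_avoid_after iid _ _.
  have tF : trivIset setT F.
    apply/trivIsetP => i j _ _; wlog ij : i j / (i < j)%N => [wl ne|].
      have [ij|ji|e] := ltngtP i j; first exact: wl.
        by rewrite setIC; apply: wl; rewrite // eq_sym.
      by rewrite e eqxx in ne.
    move=> _; rewrite -subset0 => w [[_ nret] [/= wj _]].
    apply: (nret (j - i)%N); rewrite ?subn_gt0//.
    by rewrite subnKC ?(ltnW ij)// addr0.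
  rewrite -lee_fin mulr_suml -sumEFin (eq_bigr (fun n : 'I_K => P (F n))); last first.
    by move=> n _; rewrite /F (never_after iid) walk_probE -/p pfin.
  rewrite -(measure_bigsetU P mF tF K); apply: probability_le1.
  exact: bigsetU_measurable.
rewrite pfin; congr (_%:E); apply/eqP; rewrite eq_le p0 andbT leNgt; apply/negP => pp.
have [K] := unbounded ((fine p)^-1 + 1).
rewrite leNgt => /negP; apply.
rewrite (@le_lt_trans _ _ (fine p)^-1) ?ltrDl//.
by rewrite -[leRHS]mul1r ler_pdivlMr.
Qed.

Lemma walk_prob_mulrz_gt0 g z : 0 < m g -> 0 < m (- g) ->
  exists n, 0 < walk_prob P xi n (g *~ z).
Proof.
have steps y : 0 < m y -> forall k, 0 < walk_prob P xi k (y *+ k).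
  move=> y0; elim=> [|k IH]; first by rewrite mulr0n walk_prob00.
  have := @walk_prob_split 1 k (y *+ k.+1) [:: y] isT.
  rewrite big_seq1 mulrSr addrK walk_prob1.
  by apply: lt_le_trans; exact: mulr_gt0.
move=> g0 Ng0; case: z => k; first by exists k; exact: steps.
by exists k.+1; rewrite NegzE mulrNz -mulNrz; exact: steps.
Qed.

(** A path that visits [x] only finitely often either never visits [x] after time
0 or has a last visit, so both kinds of path must be shown negligible. No visited
point has a last visit, since returns are certain. A path from 0 that reaches [- y]
returns to 0 almost surely, and seen from [- y] this return is a visit to [y]; as
[- y] is reached with positive probability, a walk from 0 visits [y]. *)
Lemma recurrent_criterion :
  (forall M : R, exists K, M <= \sum_(n < K) walk_prob P xi n 0) ->
  (forall x, exists n, 0 < walk_prob P xi n x) ->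
  recurrent P (walk xi).
Proof.
move=> unbounded reach x.
have ret := never_return0 unbounded.
pose F n z := [set w | walk xi n w = z] `&`
  [set w | forall j, (1 <= j)%N -> walk xi (n + j) w <> z + 0].
have F0 n z : P (F n z) = 0%E by rewrite /F (never_after iid) ret mule0.
have mF n z y : measurable ([set w | walk xi n w = z] `&`
    [set w | forall j, (1 <= j)%N -> walk xi (n + j) w <> y]).
  apply: measurableI; first exact: measurable_walk1.
  exact: measurable_avoid_after iid _ _.
have mUF z : measurable (\bigcup_n F n z) by apply: bigcupT_measurable => n; exact: mF.
have UF0 z : P (\bigcup_n F n z) = 0%E.
  apply/eqP; rewrite eq_le measure_ge0 andbT.
  rewrite (le_trans (measure_sigma_subadditive P (fun n => mF n z (z + 0)) (mUF z) _))//.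
  by rewrite eseries0// => n _ _; exact: F0.
have hit y : P (never xi y) = 0%E.
  have [n n0] := reach (- y).
  have : P ([set w | walk xi n w = - y] `&`
      [set w | forall j, (1 <= j)%N -> walk xi (n + j) w <> - y + y]) = 0%E.
    apply/eqP; rewrite eq_le measure_ge0 andbT -(UF0 0).
    apply: le_measure; rewrite ?inE// => w [_ /= h].
    have [||l [wl hl]] := @last_visit (fun k => walk xi k w = 0) 0 n.
    - by rewrite /walk big_ord0.
    - move=> k nk; have := h (k - n)%N.
      by rewrite subn_gt0 subnKC ?(ltnW nk)// addNr; apply.
    by exists l => //; split => // j j1; rewrite addr0; exact: hl.
  rewrite (never_after iid) walk_probE => /eqP; rewrite mule_eq0 => /orP[|/eqP//].
  by rewrite eqe gt_eqF.
have -> : [set w | infinite_set [set n | (1 <= n)%N /\ walk xi n w = x]] =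
    ~` (never xi x `|` \bigcup_n F n x).
  apply/seteqP; split=> w /=.
    move=> inf [nev|[n _ [_ Fn]]]; apply: inf.
      rewrite (_ : [set n | _] = set0)//.
      by rewrite -subset0 => n [n1]; exact: nev.
    apply: (@sub_finite_set _ _ `I_n.+1); last exact: finite_II.
    move=> k [k1 wk] /=; rewrite ltnNge; apply/negP => nk.
    apply: (Fn (k - n)%N); rewrite ?subn_gt0//.
    by rewrite subnKC ?(ltnW nk)// addr0.
  move=> /not_orP[nev nF] fin.
  have [N NP] : exists N, forall n, (N < n)%N -> ~ ((1 <= n)%N /\ walk xi n w = x).
    move/finite_seqP: fin => [s sE]; exists (\max_(n <- s) n) => n.
    rewrite ltnNge => /negP sn visit; apply: sn.
    have : [set` s] n by rewrite -sE.
    by move=> ns; apply: leq_bigmax_seq.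
  apply: nev => j j1 wj.
  have [l [[l1 wl] hl]] := @last_visit (fun n => (1 <= n)%N /\ walk xi n w = x) j N (conj j1 wj) NP.
  apply: nF; exists l => //; split => // i i1; rewrite addr0 => wi.
  by apply: (hl i i1); split => //; rewrite addn_gt0 l1.
have mZ : measurable (never xi x `|` \bigcup_n F n x).
  by apply: measurableU => //; exact: measurable_never iid _.
rewrite probability_setC// [X in (1 - X)%E](_ : _ = 0%E) ?sube0//.
rewrite measureU0; [exact: hit | | exact: mUF | exact: UF0].
exact: measurable_never iid _.
Qed.
End recurrence.

(** * A lower bound for return probabilities *)

Section averaging.
Context (R : realType) (q : nat -> R) (s : nat -> int) (n : nat).
Context (q_ge0 : forall j, 0 <= q j).

Definition avg (f : int -> R) (y : int) : R :=
  \sum_(j < n) q j / 2 * (f (y + s j) + f (y - s j)).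

(** The [k]-step transition probability from [y] to [x] of the walk on the integers
whose steps [+ s j] and [- s j] have weight [q j / 2], and which is killed with the
remaining probability. *)
Definition killed_prob (k : nat) (x y : int) : R :=
  iter k avg (fun z => (z == x)%:R) y.

Lemma killed_prob_ge0 k x y : 0 <= killed_prob k x y.
Proof.
rewrite /killed_prob; elim: k y => [|k IH] y /=; first exact: ler0n.
by apply: sumr_ge0 => j _; rewrite mulr_ge0 ?divr_ge0 ?addr_ge0.
Qed.

Lemma killed_probN k x y : killed_prob k (- x) (- y) = killed_prob k x y.
Proof.
rewrite /killed_prob; elim: k y => [|k IH] y /=; first by rewrite eqr_opp.
apply: eq_bigr => j _; congr (_ * _).
by rewrite -(IH (y + s j)) -(IH (y - s j)) [LHS]addrC opprD opprB [s j - y]addrC.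
Qed.

Lemma sum_killed_prob (r : seq int) k y :
  \sum_(x <- r) killed_prob k x y =
  iter k avg (fun z => \sum_(x <- r) (z == x)%:R) y.
Proof.
rewrite /killed_prob; elim: k y => [//|k IH] y /=.
rewrite exchange_big/=; apply: eq_bigr => j _.
by rewrite -!IH -big_split/= mulr_sumr.
Qed.

(** Chebyshev in operator form. A lower bound [1 - b y^2] on [f] is propagated by
each averaging at a cost [t] in mass and [b D^2] in variance. *)
Lemma iter_avg_ge (t b D : R) (f : int -> R) :
  0 <= t -> \sum_(j < n) q j = 1 - t -> 0 <= b ->
  (forall j, (j < n)%N -> (s j)%:~R ^+ 2 <= D ^+ 2 :> R) ->
  (forall y, 1 - b * y%:~R ^+ 2 <= f y) ->
  forall k y, 1 - k%:R * t - b * (y%:~R ^+ 2 + k%:R * D ^+ 2) <= iter k avg f y.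
Proof.
move=> t0 qt b0 sD fb k; elim: k => [|k IH] y /=.
  by rewrite !mul0r subr0 addr0; exact: fb.
have c0 : 0 <= 1 - t by rewrite -qt sumr_ge0.
set A := 1 - k%:R * t - b * k%:R * D ^+ 2.
have step (j : 'I_n) : q j * (A - b * (y%:~R ^+ 2 + D ^+ 2)) <=
    q j / 2 * (iter k avg f (y + s j) + iter k avg f (y - s j)).
  rewrite -mulrA; apply: ler_wpM2l => //.
  have := IH (y + s j); have := IH (y - s j); have := sD _ (ltn_ord j).
  rewrite /A intrB intrD.
  move: (iter k avg f (y + s j)) (iter k avg f (y - s j)) => F G.
  move: (y%:~R) ((s j)%:~R) => Y S SD h1 h2.
  have : b * S ^+ 2 <= b * D ^+ 2 by exact: ler_wpM2l.
  nra.
apply: le_trans (ler_sum _ (fun j _ => step j)).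
rewrite -mulr_suml qt /A -natr1.
have k0 : 0 <= k%:R :> R by exact: ler0n.
have h1 : 0 <= k%:R * t * t by rewrite !mulr_ge0.
have D0 := sqr_ge0 D; have y0 := sqr_ge0 (y%:~R : R).
have h2 : 0 <= b * D ^+ 2 * k%:R * t by apply: mulr_ge0 => //; apply: mulr_ge0 => //; exact: mulr_ge0.
have h3 : 0 <= b * (y%:~R ^+ 2 + D ^+ 2) * t.
  by apply: mulr_ge0 => //; apply: mulr_ge0 => //; exact: addr_ge0.
nra.
Qed.

End averaging.

(** The killed walk is a lower bound for the walk itself as soon as the integers
[s j] are the coordinates of distinct steps along a common generator [g]. *)
Section lattice.
Context d (T : measurableType d) (R : realType) (P : probability T R).
Context (X : countZmodType) (m : X -> R) (xi : nat -> T -> X).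
Context (iid : iid_steps P m xi).
Context (q : nat -> R) (s : nat -> int) (n : nat) (g : X).
Context (q_ge0 : forall j, 0 <= q j).
Context (law_steps : forall j, (j < n)%N ->
  m (g *~ s j) = q j / 2 /\ m (- (g *~ s j)) = q j / 2).
Context (uniq_steps : uniq ([seq g *~ s j | j <- index_iota 0 n] ++
                            [seq - (g *~ s j) | j <- index_iota 0 n])).
Context (g_inj : injective (fun z : int => g *~ z)).
Local Notation u := (walk_prob P xi).

Lemma killed_prob_le k x y : killed_prob q s n k x y <= u k (g *~ (x - y)).
Proof.
rewrite /killed_prob; elim: k y => [|k IH] y /=.
  by case: eqP => [->|_]; rewrite ?subrr ?mulr0z ?walk_prob00 ?walk_prob_ge0.
apply: le_trans (walk_prob_split iid 1 k (g *~ (x - y)) uniq_steps).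
rewrite big_cat !big_map/= -big_split/= big_mkord.
apply: ler_sum => j _; rewrite !(walk_prob1 iid).
have [-> ->] := law_steps (ltn_ord j).
have q2 : 0 <= q j / 2 by rewrite divr_ge0.
rewrite mulrDr opprK; apply: lerD; apply: ler_wpM2l => //.
  by apply: le_trans (IH _) _; rewrite -mulrzBr opprD addrA.
by apply: le_trans (IH _) _; rewrite -mulrzDr opprB addrA addrAC.
Qed.

(** The intermediate points are the lattice points of the box of radius
[2 h = 2 D sqrt k], twice the bound on the standard deviation: leaving it costs at
most 1/4 of the mass by Chebyshev, being killed costs at most 1/2, so 1/4 is left to
spread over at most [5 h] points. *)
Lemma return_prob_ge (t D : R) (k : nat) :
  0 <= t -> \sum_(j < n) q j = 1 - t -> 1 <= D ->
  (forall j, (j < n)%N -> (s j)%:~R ^+ 2 <= D ^+ 2 :> R) ->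
  (1 <= k)%N -> k%:R * t <= 1 / 2 ->
  (80 * (D * Num.sqrt k%:R))^-1 <= u (k + k)%N 0.
Proof.
move=> t0 qt D1 sD k1 kt.
have sk1 : 1 <= Num.sqrt k%:R :> R by rewrite -[leLHS]sqrtr1 ler_sqrt ?ler1n// ltr0n.
have sk2 : Num.sqrt k%:R ^+ 2 = k%:R :> R by rewrite sqr_sqrtr.
have D0 : 0 < D by exact: lt_le_trans D1.
set h := D * Num.sqrt k%:R.
have h1 : 1 <= h by rewrite -[leLHS]mulr1 ler_pM.
have h0 : 0 < h by exact: lt_le_trans h1.
set M := Num.truncn (2 * h).
have [Ml Mu] : M%:R <= 2 * h /\ 2 * h < M.+1%:R by apply/andP/truncn_itv; rewrite mulr_ge0// ltW.
pose r : seq int := [seq i%:Z - M%:Z | i <- iota 0 (M.*2.+1)].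
have size_r : (size r)%:R <= 5 * h.
  rewrite size_map size_iota -natr1 -muln2 natrM; nra.
have size_r0 : 0 < (size r)%:R :> R by rewrite size_map size_iota ltr0n.
have ur : uniq r by rewrite map_inj_uniq ?iota_uniq// => i j /addIr [].
pose f (z : int) : R := \sum_(x <- r) (z == x)%:R.
have h2 : 0 < 4 * h ^+ 2 by apply: mulr_gt0 => //; exact: exprn_gt0.
pose b := (4 * h ^+ 2)^-1.
have b0 : 0 <= b by rewrite invr_ge0 ltW.
have fb z : 1 - b * z%:~R ^+ 2 <= f z.
  have [zM|Mz] := leP `|z| M%:Z.
    have zr : z \in r.
      apply/mapP; exists (absz (z + M%:Z)); last first.
        rewrite gez0_abs ?addrK// -lerBlDr sub0r.
        by move: zM; rewrite ler_norml => /andP[].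
      rewrite mem_iota/= add0n ltnS -lez_nat gez0_abs -?lerBlDr ?sub0r; last first.
        by move: zM; rewrite ler_norml => /andP[].
      by rewrite -addnn PoszD lerD2r; move: zM; rewrite ler_norml => /andP[].
    rewrite /f (bigD1_seq z)//= eqxx mulr1n.
    have : 0 <= \sum_(i <- r | i != z) (z == i)%:R :> R by apply: sumr_ge0.
    have : 0 <= b * z%:~R ^+ 2 by rewrite mulr_ge0 ?sqr_ge0.
    lra.
  have f0 : 0 <= f z by apply: sumr_ge0.
  suff : 1 <= b * z%:~R ^+ 2 by lra.
  rewrite mulrC ler_pdivlMr// mul1r.
  have : M.+1%:R <= `|z%:~R| :> R by rewrite -intr_norm -[M.+1%:R]/(M.+1%:~R) ler_int.
  rewrite -[z%:~R ^+ 2]real_normK ?num_real//.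
  nra.
have := iter_avg_ge q_ge0 t0 qt b0 sD fb k 0.
rewrite -sum_killed_prob -/(f _) expr0n add0r.
have -> : b * (k%:R * D ^+ 2) = 1 / 4.
  rewrite /b /h exprMn sk2; field.
  by rewrite (gt_eqF D0) pnatr_eq0 -lt0n k1.
set p := killed_prob q s n k => pge.
have {}pge : 1 / 4 <= \sum_(x <- r) p x 0 by lra.
have ug : uniq [seq g *~ x | x <- r] by rewrite map_inj_uniq.
apply: le_trans (walk_prob_split iid k k 0 ug); rewrite big_map.
(* Cauchy-Schwarz, in the linearised form [p^2 >= 2 a p - a^2] with [a] the mean
   weight of a point when the total weight is exactly 1/4. *)
pose a : R := (4 * (size r)%:R)^-1.
have a0 : 0 <= a by rewrite invr_ge0 mulr_ge0.
have term x : x \in r -> 2 * a * p x 0 - a ^+ 2 <=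
    u k (g *~ x) * u k (0 - g *~ x).
  move=> _; apply: (@le_trans _ _ (p x 0 * p x 0)).
    have := sqr_ge0 (p x 0 - a); nra.
  apply: ler_pM; rewrite ?killed_prob_ge0//.
    by rewrite (le_trans (killed_prob_le _ _ _))// subr0.
  rewrite -[X in p _ X]oppr0 -[x]opprK /p killed_probN.
  by rewrite (le_trans (killed_prob_le _ _ _))// subr0 sub0r -mulrNz opprK.
rewrite big_seq; apply: le_trans (ler_sum _ term); rewrite -big_seq.
rewrite sumrB -mulr_sumr big_const_seq count_predT iter_addr_0 -[_ *+ size r]mulr_natr.
have ar : a * (size r)%:R = 1 / 4 by rewrite /a; field; exact: lt0r_neq0.
have ah : (20 * h)^-1 <= a.
  rewrite /a lef_pV2 ?posrE ?mulr_gt0//; nra.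
have -> : (80 * h)^-1 = (20 * h)^-1 / 4 by field; exact: lt0r_neq0.
nra.
Qed.
End lattice.

(** * Summing the local bounds *)

Lemma eseries_oo_unbounded (R : realType) (f : nat -> R) (n0 : nat) :
  (forall n, 0 <= f n) -> (\sum_(n0 <= n <oo) (f n)%:E)%E = +oo%E ->
  forall M, exists N, M <= \sum_(n < N) f n.
Proof.
move=> f0 foo M; apply: contrapT => no.
have bound N : \sum_(n < N) f n <= M.
  by rewrite leNgt; apply/negP => MN; apply: no; exists N; exact: ltW.
have : (\sum_(n0 <= n <oo) (f n)%:E <= M%:E)%E.
  apply: lime_le.
    by apply: is_cvg_nneseries => n _ _; rewrite lee_fin.
  near=> N; rewrite sumEFin lee_fin (le_trans _ (bound N))//.
  have n0N : (n0 <= N)%N by near: N; exact: nbhs_infty_ge.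
  rewrite -[leRHS](big_mkord xpredT) [leRHS](big_cat_nat (n := n0))//=.
  by rewrite lerDr sumr_ge0.
by rewrite foo leye_eq.
Unshelve. all: by end_near.
Qed.

Lemma unbounded_support (R : realType) (f : nat -> R) :
  (forall n, 0 <= f n) -> (forall M, exists N, M <= \sum_(n < N) f n) ->
  forall n, exists2 N, (n <= N)%N & f N <> 0.
Proof.
move=> f0 unb n; apply: contrapT => no.
have tail0 N : (n <= N)%N -> f N = 0.
  by move=> nN; apply: contrapT => fN; apply: no; exists N.
have [N] := unb (1 + \sum_(i < n) f i); apply/negP; rewrite -ltNge.
apply: (@le_lt_trans _ _ (\sum_(i < n) f i)); last by rewrite ltrDr.
have -> : \sum_(i < n) f i = \sum_(i < n + N) f i.
  rewrite big_split_ord/= [X in _ + X]big1 ?addr0// => i _.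
  by rewrite tail0// leq_addr.
by rewrite addnC big_split_ord/= lerDl sumr_ge0.
Qed.

Lemma sum_inv_doubling (R : realType) (D : nat -> R) (N : nat) :
  (forall n, 0 < D n) -> (forall n, 2 * D n <= D n.+1) ->
  \sum_(n < N) (D n)^-1 <= 2 * (D 0%N)^-1.
Proof.
elim: N D => [|N IH] D D0 D2; first by rewrite big_ord0 mulr_ge0// invr_ge0 ltW.
rewrite big_ord_recl.
have ih := IH (D \o S) (fun n => D0 n.+1) (fun n => D2 n.+1).
apply: le_trans (lerD (lexx _) ih) _ => /=.
have : (D 1%N)^-1 <= (2 * D 0%N)^-1 by rewrite lef_pV2 ?posrE ?mulr_gt0.
rewrite invfM; lra.
Qed.

(** A sum of terms that at least halve at each step is at most twice its first
term, and the bound [G] covers the first index selected by [Q]. *)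
Lemma sum_inv_doubling_le (R : realType) (D : nat -> R) (Q : pred nat) (G : R) (N : nat) :
  (forall n, 0 < D n) -> (forall n, 2 * D n <= D n.+1) -> 0 <= G ->
  (forall n, Q n -> (D n)^-1 <= G) ->
  \sum_(n < N | Q n) (D n)^-1 <= 2 * G.
Proof.
move=> D0 D2 G0; elim: N D Q D0 D2 => [|N IH] D Q D0 D2 QG.
  by rewrite big_ord0 mulr_ge0.
have [Q0|nQ0] := boolP (Q 0%N).
  apply: (@le_trans _ _ (2 * (D 0%N)^-1)); last by rewrite ler_pM2l// QG.
  apply: le_trans (sum_inv_doubling N.+1 D0 D2).
  rewrite big_mkcond; apply: ler_sum => n _; case: ifP => // _.
  by rewrite invr_ge0 ltW.
rewrite big_mkcond big_ord_recl /= (negPf nQ0) add0r -big_mkcond/=.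
exact: (IH (D \o S) (Q \o S) (fun n => D0 n.+1) (fun n => D2 n.+1)
  (fun n => QG n.+1)).
Qed.

Lemma sqrt_le_sum_inv_sqrt (R : realType) (m : nat) :
  Num.sqrt m%:R <= \sum_(k < m) (Num.sqrt k.+1%:R)^-1 :> R.
Proof.
elim: m => [|m IH]; first by rewrite big_ord0 sqrtr0.
rewrite big_ord_recr/=; apply: le_trans (lerD IH (lexx _)).
have a0 : 0 <= Num.sqrt m%:R :> R by exact: sqrtr_ge0.
have b0 : 0 < Num.sqrt m.+1%:R :> R by rewrite sqrtr_gt0 ltr0n.
have a2 : Num.sqrt m%:R ^+ 2 = m%:R :> R by rewrite sqr_sqrtr.
have b2 : Num.sqrt m.+1%:R ^+ 2 = m.+1%:R :> R by rewrite sqr_sqrtr.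
have ab : Num.sqrt m%:R <= Num.sqrt m.+1%:R :> R by rewrite ler_sqrt ?ler_nat.
rewrite -lerBlDl -[leRHS]mul1r ler_pdivlMr//.
have := mulr_ge0 a0 (_ : 0 <= Num.sqrt m.+1%:R - Num.sqrt m%:R :> R).
rewrite subr_ge0 => /(_ ab).
move: (Num.sqrt _) (Num.sqrt _) a2 b2 => b a a2 b2.
move: b2; rewrite -natr1 -a2; nra.
Qed.

(** For [0 < t] and [M] the integer part of [1 / (2 t)],
[sqrt M + 1 >= sqrt (M + 1) > sqrt (1 / (2 t))], so the loss of 1 pays for rounding
down. At [t = 0] both inverses are 0. *)
Lemma inv_sqrt_le_truncn (R : realType) (t : R) : 0 <= t ->
  (Num.sqrt t)^-1 / 2 - 1 <= Num.sqrt (Num.truncn (2 * t)^-1)%:R.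
Proof.
rewrite le_eqVlt => /orP[/eqP <-|t0].
  by rewrite sqrtr0 invr0 mul0r sub0r (le_trans _ (sqrtr_ge0 _))// lerN10.
have s0 : 0 < Num.sqrt t by rewrite sqrtr_gt0.
have s2 : Num.sqrt t ^+ 2 = t by rewrite sqr_sqrtr// ltW.
set v := (Num.sqrt t)^-1; have v0 : 0 < v by rewrite invr_gt0.
have tv : (2 * t)^-1 = v ^+ 2 / 2 by rewrite -s2 invfM exprVn mulrC.
have /andP[_] : (Num.truncn (2 * t)^-1)%:R <= (2 * t)^-1 <
    (Num.truncn (2 * t)^-1).+1%:R by apply: truncn_itv; rewrite tv divr_ge0 ?sqr_ge0.
set M := Num.truncn _; rewrite tv -[M.+1%:R]natr1.
have := sqrtr_ge0 (M%:R : R); have : Num.sqrt M%:R ^+ 2 = M%:R :> R by rewrite sqr_sqrtr.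
move: (Num.sqrt _) => r <- r0 vr; rewrite leNgt; apply/negP => rv.
have := mulr_gt0 v0 v0; nra.
Qed.

(** The local bound holds on the region [k <= m n]. Summed over [k] first, the
terms [1 / (D n sqrt k)] of this region recover [1 / (D n sqrt (t n))] up to a
summable error; summed over [n] first, they are geometric and at most twice the
best local bound on [g k]. *)
Lemma sum_unbounded_of_local_bound (R : realType) (D t g : nat -> R) :
  (forall n, 0 < D n) -> (forall n, 2 * D n <= D n.+1) ->
  (forall n, 0 <= t n) -> (forall k, 0 <= g k) ->
  (forall n k, (1 <= k)%N -> k%:R * t n <= 1 / 2 ->
    (80 * (D n * Num.sqrt k%:R))^-1 <= g k) ->
  (forall M, exists N, M <= \sum_(n < N) (D n * Num.sqrt (t n))^-1) ->
  forall M, exists K, M <= \sum_(k < K) g k.+1.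
Proof.
move=> D0 D2 t0 g0 loc unb M.
have [N NM] := unb (2 * (160 * M + 2 * (D 0%N)^-1)).
pose m n := Num.truncn (2 * t n)^-1 : nat.
pose K := \max_(n < N) m n; exists K.
have mK (n : 'I_N) : (m n <= K)%N by apply: (leq_bigmax (F := fun n : 'I_N => m n)).
have sqrt0 k : 0 < Num.sqrt k.+1%:R :> R by rewrite sqrtr_gt0 ltr0n.
have low (n : 'I_N) : (D n)^-1 * ((Num.sqrt (t n))^-1 / 2 - 1) <=
    \sum_(k < K | (k < m n)%N) (D n)^-1 * (Num.sqrt k.+1%:R)^-1.
  rewrite -mulr_sumr ler_pM2l ?invr_gt0//.
  rewrite -(big_ord_widen K (fun k => (Num.sqrt k.+1%:R)^-1) (mK n)).
  exact: le_trans (inv_sqrt_le_truncn (t0 n)) (sqrt_le_sum_inv_sqrt _ _).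
have up (k : 'I_K) : \sum_(n < N | (k < m n)%N) (D n)^-1 * (Num.sqrt k.+1%:R)^-1 <=
    160 * g k.+1.
  rewrite -mulr_suml -ler_pdivlMr ?invr_gt0// invrK.
  have -> : 160 * g k.+1 * Num.sqrt k.+1%:R = 2 * (80 * g k.+1 * Num.sqrt k.+1%:R) by ring.
  apply: (@sum_inv_doubling_le _ D (fun n => (k < m n)%N)) => //.
    by rewrite !mulr_ge0// ltW.
  move=> n kn; have tn : 0 < t n.
    rewrite lt_neqAle t0 andbT; apply/eqP => tn0; move: kn.
    by rewrite /m -tn0 mulr0 invr0 truncn0.
  have /loc : k.+1%:R * t n <= 1 / 2.
    have : k.+1%:R <= (2 * t n)^-1.
      apply: (@le_trans _ _ (m n)%:R); first by rewrite ler_nat.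
      have v0 : 0 <= (2 * t n)^-1 by rewrite invr_ge0 mulr_ge0.
      by case/andP: (truncn_itv v0).
    by rewrite invfM -ler_pdivrMr ?invr_gt0// invrK; lra.
  move=> /(_ isT).
  rewrite !invfM => h.
  have -> : (D n)^-1 = 80 * (80^-1 * ((D n)^-1 * (Num.sqrt k.+1%:R)^-1)) * Num.sqrt k.+1%:R.
    by field; rewrite !lt0r_neq0.
  by rewrite ler_pM2r// ler_pM2l.
have main : \sum_(n < N) (D n)^-1 * ((Num.sqrt (t n))^-1 / 2 - 1) <=
    160 * \sum_(k < K) g k.+1.
  apply: le_trans (ler_sum _ (fun n _ => low n)) _.
  rewrite (exchange_big_dep xpredT)//= mulr_sumr.
  exact: ler_sum (fun k _ => up k).
have := sum_inv_doubling N D0 D2 => geo.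
move: main; under eq_bigr do rewrite mulrBr mulr1 mulrA -invfM.
rewrite sumrB -mulr_suml.
move: NM geo; lra.
Qed.

(** * The group [H a] and the increments *)

Lemma iid_steps_of_iid d (T : measurableType d) (R : realType)
    (P : probability T R) (a : nat -> int) (mu : probability (H a) R)
    (xi : nat -> {RV P >-> H a}) :
  iid_with_distribution mu xi ->
  iid_steps P (fun x => fine (mu [set x])) (fun i => xi i : T -> H a).
Proof.
move=> [law indep]; split=> [i x|n v]; first exact: measurable_funPTI.
pose J := seq_fset tt (iota n (size v)).
pose A i := [set nth 0 v (i - n)].
have JE i : (i \in J) = (n <= i < n + size v)%N.
  by rewrite seq_fsetE mem_iota.
have -> : block (fun i => xi i : T -> H a) n (size v) @^-1` [set v] =
    \bigcap_(i in [set` J]) (xi i @^-1` A i).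
  apply/seteqP; split=> w /=.
    move=> bv i /=; rewrite JE => /andP[ni iv].
    rewrite /A /= -bv (nth_map 0%N) ?size_iota ?nth_iota ?subnKC//;
      by rewrite ltn_subLR.
  move=> bv; apply: (@eq_from_nth _ 0) => [|i]; rewrite size_block// => iv.
  rewrite (nth_map 0%N) ?size_iota// nth_iota//.
  have /= := bv (n + i)%N; rewrite JE leq_addr ltn_add2l iv => /(_ isT).
  by rewrite /A addKn.
rewrite indep// (perm_big (iota n (size v))); last first.
  by rewrite (perm_trans (seq_fset_perm _ _))// undup_id ?iota_uniq.
rewrite -[n in iota n]addn0 iotaDl big_map -prodEFin.
rewrite [in RHS](big_nth 0) [RHS](_ : _ =
  \prod_(i <- iota 0 (size v)) (fine (mu [set nth 0 v i]))%:E)%E; last first.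
  by rewrite /index_iota subn0.
apply: eq_bigr => i _; rewrite /A addKn fineK; last exact: fin_num_measure.
exact: law.
Qed.

Section radix.
Context (a : nat -> int) (ha : forall j, (1 <= j)%N -> 1 < a j).

Lemma denom_gt0 n : 0 < denom a n.
Proof.
rewrite /denom big_nat; apply: prodr_gt0 => i /andP[i1 _].
exact: lt_trans (ha i1).
Qed.

Lemma denomS n : denom a n.+1 = denom a n * a n.+1.
Proof. by rewrite /denom big_nat_recr. Qed.

Lemma denom_double n : 2 * denom a n <= denom a n.+1.
Proof.
have a2 : 2 <= a n.+1 by rewrite -[2]/(1 + 1 : int) lez1D ha.
by rewrite denomS mulrC ler_wpM2l// ltW// denom_gt0.
Qed.

(** For [j <= n], the coordinate of the step [e ha j] on the lattice generated by
[e ha n]. *)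
Definition ratio (n j : nat) : int := \prod_(j.+1 <= i < n.+1) a i.

Lemma denom_ratio n j : (j <= n)%N -> denom a n = denom a j * ratio n j.
Proof. by move=> jn; rewrite /denom (@big_cat_nat _ _ _ j.+1 1 n.+1). Qed.

Lemma ratio_gt0 n j : (j <= n)%N -> 0 < ratio n j.
Proof. by move=> jn; rewrite -(pmulr_rgt0 _ (denom_gt0 j)) -denom_ratio ?denom_gt0. Qed.

Lemma ratio_le n j : (j <= n)%N -> ratio n j <= denom a n.
Proof.
move=> jn; rewrite (denom_ratio jn) ler_peMl ?(ltW (ratio_gt0 jn))//.
by rewrite -gtz0_ge1 denom_gt0.
Qed.

Lemma val_mulrz (x : H a) (z : int) : val (x *~ z) = val x *~ z.
Proof. exact: raddfMz. Qed.

Lemma denomQ_neq0 n : (denom a n)%:~R != 0 :> rat.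
Proof. by rewrite intr_eq0 gt_eqF// denom_gt0. Qed.

Lemma e_ratio n j : (j <= n)%N -> e ha n *~ ratio n j = e ha j.
Proof.
move=> jn; apply: val_inj; rewrite val_mulrz /=.
have := denomQ_neq0 n; rewrite (denom_ratio jn) intrM mulf_eq0 negb_or => /andP[j0 r0].
by rewrite -mulrzr invfM mulrAC -mulrA mulfV// mulr1.
Qed.

Lemma mulrz_e_inj n : injective (fun z : int => e ha n *~ z).
Proof.
move=> z1 z2 /(congr1 val); rewrite [LHS]val_mulrz [RHS]val_mulrz.
by apply: mulrIz; rewrite invr_eq0 denomQ_neq0.
Qed.

Lemma denom_inj : injective (denom a).
Proof.
have inc : {homo denom a : i j / (i < j)%N >-> i < j}.
  apply: homo_ltn lt_trans _ => n; apply: lt_le_trans (denom_double n).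
  by rewrite mulr_natl mulr2n ltrDl denom_gt0.
by move=> i j e; case: (ltngtP i j) => // /inc; rewrite e ltxx.
Qed.

Lemma e_inj : injective (e ha).
Proof. by move=> i j /(congr1 val) /= /invr_inj /intr_inj /denom_inj. Qed.

Lemma uniq_steps n :
  uniq ([seq e ha n *~ ratio n j | j <- index_iota 0 n] ++
        [seq - (e ha n *~ ratio n j) | j <- index_iota 0 n]).
Proof.
have toe (f : H a -> H a) : [seq f (e ha n *~ ratio n j) | j <- index_iota 0 n] =
    [seq f (e ha j) | j <- index_iota 0 n].
  apply/eq_in_map => j; rewrite mem_index_iota => /andP[_ jn].
  by rewrite e_ratio// ltnW.
rewrite (toe id) (toe -%R) cat_uniq (map_inj_uniq e_inj) iota_uniq/=.
apply/andP; split; last first.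
  by rewrite map_inj_uniq ?iota_uniq// => i j /oppr_inj/e_inj.
apply/hasPn => _ /mapP[j _ ->]; apply/mapP => -[i _] /(congr1 val) /=.
have pos k : 0 < (denom a k)%:~R^-1 :> rat by rewrite invr_gt0 ltr0z denom_gt0.
by have := pos i; have := pos j; lra.
Qed.

Lemma H_lattice (x : H a) : exists n z, x = e ha n *~ z.
Proof.
have /asboolP[n [_ [z xz]]] := valP x; exists n, z; apply: val_inj.
by rewrite val_mulrz /= -mulrzl -xz.
Qed.

Lemma e_refine n N z : (n <= N)%N -> e ha n *~ z = e ha N *~ (ratio N n * z).
Proof. by move=> nN; rewrite mulrzA e_ratio. Qed.

End radix.

Section tails.
Context (R : realType) (q : nat -> R) (hq0 : forall j, 0 <= q j).
Context (hq1 : (\sum_(0 <= j <oo) (q j)%:E)%E = 1%E).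

Lemma tailE n : (\sum_(n <= j <oo) (q j)%:E)%E = (tail q n)%:E.
Proof.
rewrite /tail fineK// ge0_fin_numE; last first.
  by apply: nneseries_ge0 => j _ _; rewrite lee_fin.
apply: (@le_lt_trans _ _ 1%E); last by rewrite ltry.
rewrite -hq1 (@nneseries_split _ _ 0%N n); last by move=> k _; rewrite lee_fin.
rewrite add0n leeDr// sumEFin lee_fin; exact: sumr_ge0.
Qed.

Lemma tail_ge0 n : 0 <= tail q n.
Proof. by apply: fine_ge0; apply: nneseries_ge0 => j _ _; rewrite lee_fin. Qed.

Lemma sum_head n : \sum_(j < n) q j = 1 - tail q n.
Proof.
have := hq1; rewrite (@nneseries_split _ _ 0%N n); last by move=> k _; rewrite lee_fin.
rewrite add0n tailE sumEFin big_mkord -EFinD => -[<-].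
by rewrite addrK.
Qed.

Lemma tail_eq0 n N : (n <= N)%N -> (forall j, (n <= j)%N -> q j = 0) -> tail q N = 0.
Proof.
move=> nN q0; rewrite /tail eseries0// => j Nj _.
by rewrite q0// (leq_trans nN).
Qed.
End tails.

Theorem theorem1 (R : realType)
  (a : nat -> int) (ha : forall j : nat, (1 <= j)%N -> 1 < a j)
  (q : nat -> R) (hq0 : forall j : nat, 0 <= q j)
  (hq1 : (\sum_(0 <= j <oo) (q j)%:E)%E = 1%E)
  (mu : probability (H a) R)
  (hmu_pos : forall j : nat, mu [set e ha j] = (q j / 2)%:E)
  (hmu_neg : forall j : nat, mu [set - e ha j] = (q j / 2)%:E)
  (hdiv : recurrence_condition a q)
  (d : measure_display) (T : measurableType d) (P : probability T R)
  (xi : nat -> {RV P >-> H a})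
  (hxi : iid_with_distribution mu xi) :
  recurrent P (walk (fun i => xi i : T -> H a)).
Proof.
have iid := iid_steps_of_iid hxi.
set S := fun i => xi i : T -> H a in iid *.
set m := fun x => _ in iid.
have law_e j : m (e ha j) = q j / 2 /\ m (- e ha j) = q j / 2.
  by rewrite /m hmu_pos hmu_neg.
have D0 n : 0 < (denom a n)%:~R :> R by rewrite ltr0z denom_gt0.
have D2 n : 2 * (denom a n)%:~R <= (denom a n.+1)%:~R :> R.
  by rewrite -[2]/(2%:~R) -intrM ler_int denom_double.
have term_ge0 n : 0 <= ((denom a n)%:~R * Num.sqrt (tail q n))^-1.
  by rewrite invr_ge0 mulr_ge0 ?sqrtr_ge0// ltW.
have unb := eseries_oo_unbounded term_ge0 hdiv.
apply: (recurrent_criterion iid).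
- have loc n k : (1 <= k)%N -> k%:R * tail q n <= 1 / 2 ->
      (80 * ((denom a n)%:~R * Num.sqrt k%:R))^-1 <= walk_prob P S (k + k) 0.
    apply: (return_prob_ge iid hq0 (s := ratio a n) (n := n) (g := e ha n)).
    + by move=> j jn; rewrite e_ratio ?(ltnW jn).
    + exact: uniq_steps.
    + exact: mulrz_e_inj.
    + exact: tail_ge0.
    + exact: sum_head.
    + by rewrite ler1z -gtz0_ge1 denom_gt0.
    + move=> j jn; have r0 : 0 < (ratio a n j)%:~R :> R.
        by rewrite ltr0z (ratio_gt0 ha (ltnW jn)).
      rewrite ler_sqr ?nnegrE ?(ltW r0) ?(ltW (D0 n))// ler_int.
      exact: (ratio_le ha (ltnW jn)).
  have S0 := @walk_prob_ge0 _ _ _ P _ S.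
  move=> M; have [K KM] := sum_unbounded_of_local_bound D0 D2 (tail_ge0 hq0)
    (fun k => S0 (k + k)%N 0) loc unb M.
  (* the even times up to 2 K are among the times 0, ..., 2 K *)
  exists (K + K).+1; apply: le_trans KM _.
  rewrite big_ord_recl.
  apply: (@le_trans _ _ (\sum_(i < K + K) walk_prob P S i.+1 0)); last by rewrite lerDr.
  elim: K => [|K IH]; first by rewrite !big_ord0.
  rewrite big_ord_recr/=; have -> : (K.+1 + K.+1 = (K + K).+2)%N by rewrite addnS.
  by rewrite !big_ord_recr/= lerD2r (le_trans IH)// lerDl.
- move=> x; have [n [z ->]] := H_lattice ha x.
  (* a nonzero term of index N beyond n has a nonzero tail, hence q j > 0 for
     some j beyond n; multiples of e ha j fill the lattice containing x *)
  have [j nj qj] : exists2 j, (n <= j)%N & 0 < q j.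
    apply: contrapT => no; have [N nN] := unbounded_support term_ge0 unb n.
    apply; rewrite (@tail_eq0 _ _ n)// ?sqrtr0 ?mulr0 ?invr0// => j nj.
    apply/eqP; rewrite eq_le hq0 andbT leNgt; apply/negP => qj.
    by apply: no; exists j.
  have [mj mNj] := law_e j.
  rewrite (e_refine ha z nj); apply: (walk_prob_mulrz_gt0 iid).
    by rewrite mj divr_gt0.
  by rewrite mNj divr_gt0.
Qed.
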